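(* The $\mathbb{F}_1$-module $\mathrm{Part}$ of partitions is not the $\mathbb{F}_1$-module associated to any plasma: there is no plasma $M$ such that $\mathrm{Part}\cong\widehat{H}M$ as $\mathbb{F}_1$-modules.
   Context: Let $\mathcal{F}in_*$ be the category with objects $\underline{n}_+=\{0,1,\ldots,n\}$, $n\ge 0$, pointed at $0$, and basepoint-preserving functions. An $\mathbb{F}_1$-module is a functor $X\colon\mathcal{F}in_*\to\mathcal{S}et_*$ to pointed sets with $X(\underline{0}_+)$ a one-element set; morphisms are natural transformations. $\mathrm{Part}(\underline{n}_+)$ is the set of partitions of $\underline{n}_+$ into nonempty disjoint blocks, pointed at the partition all of whose blocks are singletons. For a pointed function $\phi\colon\underline{n}_+\to\underline{m}_+$, $\mathrm{Part}(\phi)(P)$ is the partition associated to the smallest equivalence relation on $\underline{m}_+$ containing the image under $\phi\times\phi$ of the equivalence relation associated to $P$. A plasma is a set $X$ with a hyperoperation $\star\colon X\times X\to\mathcal{P}(X)$ (empty values allowed) and an element $0\in X$ (the weak identity) such that $x\star y=y\star x$ and $x\in x\star 0$ for all $x,y$. A morphism $(X,\star,0)\to(Y,\boxplus,e)$ is a function $f$ with $f(0)=e$ and $f(x\star x')\subseteq f(x)\boxplus f(x')$. $\mathrm{Plas}(X,Y)$ is the set of plasma morphisms, pointed by the constant morphism at the weak identity. The power set plasma $\mathcal{P}(n)$ is the power set of $\{1,\ldots,n\}$ with weak identity $\varnothing$ and $a\star b=\{a\cup b\}$ if $a\cap b=\varnothing$, while $a\star b$ is the empty family otherwise. A pointed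 function $\phi\colon\underline{n}_+\to\underline{m}_+$ induces the plasma morphism $\phi^{-1}\colon\mathcal{P}(m)\to\mathcal{P}(n)$. The $\mathbb{F}_1$-module $\widehat{H}M$ associated to a plasma $M$ is $\underline{n}_+\mapsto\mathrm{Plas}(\mathcal{P}(n),M)$, with $\phi$ acting by precomposition with $\phi^{-1}$. *)

(* Defs.v *)
(* [all_boot] comes last so that [partition], [set0], ... are those of [finset]. *)
From mathcomp Require Import boolp classical_sets.
From mathcomp Require Import all_boot.
Set Implicit Arguments.
Unset Strict Implicit.
Unset Printing Implicit Defensive.

Record pset := PSet { psort :> Type; pt : psort }.
Arguments pt {p}.

Record pmap (X Y : pset) := PMap {
  pfun :> X -> Y;
  pmap_pt : pfun pt = pt }.

Lemma pmap_eq (X Y : pset) (f g : pmap X Y) : f =1 g -> f = g.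
Proof.
case: f g => [f pf] [g pg] /= /funext fg; rewrite {}fg in pf *.
by congr PMap; exact: Prop_irrelevance.
Qed.

Definition pid (X : pset) : pmap X X := @PMap X X id erefl.

Lemma pcomp_pt (X Y Z : pset) (g : pmap Y Z) (f : pmap X Y) : (g \o f) pt = pt.
Proof. by rewrite /= !pmap_pt. Qed.

Definition pcomp (X Y Z : pset) (g : pmap Y Z) (f : pmap X Y) : pmap X Z :=
  PMap (pcomp_pt g f).

(* The category Fin_* is the full subcategory of pointed sets on the [fin n]. *)
Definition fin (n : nat) : pset := @PSet 'I_n.+1 ord0.

Record f1module := F1Module {
  f1obj :> nat -> pset;
  f1map : forall m n, pmap (fin m) (fin n) -> pmap (f1obj m) (f1obj n);
  f1map_id : forall n, f1map (pid (fin n)) = pid (f1obj n);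
  f1map_comp : forall l m n (psi : pmap (fin m) (fin n))
      (phi : pmap (fin l) (fin m)),
    f1map (pcomp psi phi) = pcomp (f1map psi) (f1map phi);
  f1obj0 : forall x : f1obj 0, x = pt }.
Arguments f1map X {m n} phi : rename.

Record f1hom (X Y : f1module) := F1Hom {
  f1app :> forall n, pmap (X n) (Y n);
  f1nat : forall m n (phi : pmap (fin m) (fin n)),
    pcomp (f1app n) (f1map X phi) = pcomp (f1map Y phi) (f1app m) }.

Definition f1iso (X Y : f1module) : Prop :=
  exists (f : f1hom X Y) (g : f1hom Y X),
    (forall n, pcomp (g n) (f n) = pid (X n)) /\
    (forall n, pcomp (f n) (g n) = pid (Y n)).

(* Intersection of all the equivalence relations containing [e]; the lemmas
   below show that it is the smallest one. *)
Definition eqv_closure (T : Type) (e : rel T) : rel T := fun x y =>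
  `[< forall r : rel T, equivalence_rel r -> subrel e r -> r x y >].

Lemma sub_eqv_closure (T : Type) (e : rel T) : subrel e (eqv_closure e).
Proof. by move=> x y exy; apply/asboolP => r _; apply. Qed.

Lemma eqv_closure_min (T : Type) (e r : rel T) :
  equivalence_rel r -> subrel e r -> subrel (eqv_closure e) r.
Proof. by move=> er ser x y /asboolP; apply. Qed.

Lemma eqv_closure_equiv (T : Type) (e : rel T) :
  equivalence_rel (eqv_closure e).
Proof.
apply/equivalence_relP; split=> [x|x y /asboolP xy z].
  by apply/asboolP => r /equivalence_relP[].
by apply/asboolP/asboolP => h r er ser; have /equivalence_relP[_ lt] := er;
  have := h r er ser; rewrite (lt _ _ (xy r er ser)).
Qed.

Lemma eqv_closure_id (T : Type) (e : rel T) :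
  equivalence_rel e -> eqv_closure e =2 e.
Proof.
move=> ee x y; apply/idP/idP; last exact: sub_eqv_closure.
exact: eqv_closure_min.
Qed.

Definition part (n : nat) : predArgType :=
  {P : {set {set 'I_n.+1}} | partition P [set: 'I_n.+1]%SET}.

Definition part_rel (n : nat) (P : part n) : rel 'I_n.+1 :=
  fun x y => y \in pblock (val P) x.

Definition image_rel (T U : finType) (f : T -> U) (e : rel T) : rel U :=
  fun u v => [exists x, exists y, [&& e x y, f x == u & f y == v]].

Lemma classes_partition (n : nat) (e : rel 'I_n.+1) :
  partition (equivalence_partition (eqv_closure e) [set: 'I_n.+1]%SET)
    [set: 'I_n.+1]%SET.
Proof. by apply: equivalence_partitionP => x y z _ _ _; exact: eqv_closure_equiv. Qed.

Definition classes (n : nat) (e : rel 'I_n.+1) : part n :=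
  exist _ (equivalence_partition (eqv_closure e) [set: 'I_n.+1]%SET)
    (classes_partition e).

Definition part_map (m n : nat) (phi : fin m -> fin n) (P : part m) : part n :=
  classes (image_rel phi (part_rel P)).

Lemma singletons_partition (n : nat) :
  partition [set [set x] | x in [set: 'I_n.+1]]%SET [set: 'I_n.+1]%SET.
Proof.
apply/and3P; split.
- rewrite eqEsubset subsetT /=; apply/fintype.subsetP => x _.
  by apply/bigcupP; exists [set x]%SET; rewrite ?imset_f ?inE.
- apply/trivIsetP => _ _ /imsetP[x _ ->] /imsetP[y _ ->] xy.
  by rewrite disjoints1 inE; apply: contra xy => /eqP ->.
- by apply/imsetP => -[x _ /setP/(_ x)]; rewrite !inE eqxx.
Qed.

Definition part_pt (n : nat) : part n :=
  exist _ [set [set x] | x in [set: 'I_n.+1]]%SET (singletons_partition n).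

Lemma part_rel_equiv (n : nat) (P : part n) : equivalence_rel (part_rel P).
Proof.
move=> x y z; case: P => P pP; rewrite /part_rel /=.
exact: (pblock_equivalence pP).
Qed.

Lemma part_relK (n : nat) (P : part n) :
  equivalence_partition (part_rel P) [set: 'I_n.+1]%SET = val P.
Proof. exact: equivalence_partition_pblock (valP P). Qed.

Lemma eq_equivalence_partition (T : finType) (r s : rel T) (D : {set T}) :
  r =2 s -> equivalence_partition r D = equivalence_partition s D.
Proof.
move=> rs; apply: eq_imset => x; apply/setP => y.
by rewrite !inE rs.
Qed.

Lemma part_rel_inj (n : nat) (P Q : part n) :
  part_rel P =2 part_rel Q -> P = Q.
Proof.
move=> PQ; apply: val_inj; rewrite -(part_relK P) -(part_relK Q).
exact: eq_equivalence_partition.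
Qed.

Lemma part_rel_classes (n : nat) (e : rel 'I_n.+1) :
  part_rel (classes e) =2 eqv_closure e.
Proof.
move=> x y; rewrite /part_rel /=.
rewrite pblock_equivalence_partition ?inE//.
by move=> a b c _ _ _; exact: eqv_closure_equiv.
Qed.

Lemma part_rel_pt (n : nat) : part_rel (part_pt n) =2 eq_op.
Proof.
move=> x y; rewrite /part_rel.
have /and3P[_ tP _] := valP (part_pt n).
have xP : [set x]%SET \in val (part_pt n) by apply/imsetP; exists x.
by rewrite (def_pblock tP xP) ?inE 1?eq_sym// eq_sym.
Qed.

Lemma part_map_pt (m n : nat) (phi : pmap (fin m) (fin n)) :
  part_map phi (part_pt m) = part_pt n.
Proof.
apply: part_rel_inj => x y; rewrite part_rel_classes part_rel_pt.
have eqE : equivalence_rel (@eq_op 'I_n.+1).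
  by move=> a b c; split=> // /eqP ->.
apply/idP/idP; last first.
  by move/eqP ->; have /equivalence_relP[+ _] :=
    @eqv_closure_equiv _ (image_rel phi (part_rel (part_pt m))); apply.
apply: (eqv_closure_min eqE) => u v /existsP[a /existsP[b /and3P[]]].
by rewrite part_rel_pt => /eqP -> /eqP -> /eqP ->.
Qed.

Lemma part_map_id (n : nat) (P : part n) : part_map id P = P.
Proof.
apply: part_rel_inj => x y; rewrite part_rel_classes.
rewrite -[RHS](eqv_closure_id (part_rel_equiv P)).
suff -> : image_rel id (part_rel P) = part_rel P by [].
apply/funext => u; apply/funext => v; apply/idP/idP.
  by move=> /existsP[a /existsP[b /and3P[+ /eqP <- /eqP <-]]].
by move=> uv; apply/existsP; exists u; apply/existsP; exists v; rewrite uv !eqxx.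
Qed.

Lemma preim_equiv (T U : Type) (f : T -> U) (r : rel U) :
  equivalence_rel r -> equivalence_rel (fun x y => r (f x) (f y)).
Proof. by move=> er x y z; exact: er. Qed.

Lemma part_map_comp (l m n : nat) (psi : fin m -> fin n) (phi : fin l -> fin m)
  (P : part l) : part_map (psi \o phi) P = part_map psi (part_map phi P).
Proof.
apply: part_rel_inj => x y; rewrite !part_rel_classes.
apply/idP/idP; apply: eqv_closure_min; try exact: eqv_closure_equiv.
  move=> u v /existsP[a /existsP[b /and3P[ab /eqP <- /eqP <-]]].
  apply: sub_eqv_closure; apply/existsP; exists (phi a).
  apply/existsP; exists (phi b); rewrite !eqxx !andbT part_rel_classes.
  apply: sub_eqv_closure; apply/existsP; exists a.
  by apply/existsP; exists b; rewrite ab !eqxx.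
move=> u v /existsP[a /existsP[b /and3P[+ /eqP <- /eqP <-]]].
rewrite part_rel_classes; move: a b.
apply: eqv_closure_min; first exact/preim_equiv/eqv_closure_equiv.
move=> a b /existsP[c /existsP[d /and3P[cd /eqP <- /eqP <-]]].
apply: sub_eqv_closure; apply/existsP; exists c.
by apply/existsP; exists d; rewrite cd !eqxx.
Qed.

Definition part_pset (n : nat) : pset := PSet (part_pt n).

Definition part_pmap (m n : nat) (phi : pmap (fin m) (fin n)) :
  pmap (part_pset m) (part_pset n) :=
  @PMap (part_pset m) (part_pset n) (part_map phi) (part_map_pt phi).

Lemma part_pmap_id (n : nat) : part_pmap (pid (fin n)) = pid (part_pset n).
Proof. by apply: pmap_eq => P; exact: part_map_id. Qed.

Lemma part_pmap_comp (l m n : nat) (psi : pmap (fin m) (fin n))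
    (phi : pmap (fin l) (fin m)) :
  part_pmap (pcomp psi phi) = pcomp (part_pmap psi) (part_pmap phi).
Proof. by apply: pmap_eq => P; exact: part_map_comp. Qed.

Lemma part_pset0 (P : part_pset 0) : P = pt.
Proof.
apply: part_rel_inj => x y; rewrite !ord1.
by have /equivalence_relP[-> _] := part_rel_equiv P;
   have /equivalence_relP[-> _] := part_rel_equiv (part_pt 0).
Qed.

Definition Part : f1module :=
  @F1Module part_pset part_pmap part_pmap_id part_pmap_comp part_pset0.

Record plasma := Plasma {
  plsort :> Type;
  plop : plsort -> plsort -> set plsort;
  pl0 : plsort;
  plopC : forall x y, plop x y = plop y x;
  plop0 : forall x, plop x pl0 x }.
Arguments plop {p}.
Arguments pl0 {p}.

Record plashom (X Y : plasma) := PlasHom {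
  plfun :> X -> Y;
  plhom0 : plfun pl0 = pl0;
  plhomM : forall x x', (plfun @` plop x x' `<=` plop (plfun x) (plfun x'))%classic }.

Lemma plashom_eq (X Y : plasma) (f g : plashom X Y) : f =1 g -> f = g.
Proof.
case: f g => [f f0 fM] [g g0 gM] /= /funext fg; rewrite {}fg in f0 fM *.
by congr PlasHom; exact: Prop_irrelevance.
Qed.

Lemma plcomp0 (X Y Z : plasma) (g : plashom Y Z) (f : plashom X Y) :
  (g \o f) pl0 = pl0.
Proof. by rewrite /= !plhom0. Qed.

Lemma plcompM (X Y Z : plasma) (g : plashom Y Z) (f : plashom X Y) x x' :
  ((g \o f) @` plop x x' `<=` plop ((g \o f) x) ((g \o f) x'))%classic.
Proof.
move=> _ [c cxx' <-] /=; apply: plhomM; exists (f c) => //.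
by apply: plhomM; exists c.
Qed.

Definition plcomp (X Y Z : plasma) (g : plashom Y Z) (f : plashom X Y) :
  plashom X Z := PlasHom (plcomp0 g f) (@plcompM _ _ _ g f).

(* Subsets of {1, ..., n}, seen as the subsets of n_+ avoiding the basepoint. *)
Definition pow (n : nat) : predArgType := {A : {set 'I_n.+1} | ord0 \notin A}.

Lemma pow0_subproof (n : nat) : (ord0 : 'I_n.+1) \notin set0.
Proof. by rewrite inE. Qed.

Definition pow0 (n : nat) : pow n := exist _ set0 (pow0_subproof n).

Lemma powU_subproof (n : nat) (a b : pow n) :
  ord0 \notin (val a :|: val b)%SET.
Proof. by rewrite inE negb_or (valP a) (valP b). Qed.

Definition powU (n : nat) (a b : pow n) : pow n :=
  exist _ (val a :|: val b)%SET (powU_subproof a b).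

Definition pow_op (n : nat) (a b : pow n) : set (pow n) :=
  if [disjoint val a & val b] then [set powU a b]%classic else classical_sets.set0.

Lemma pow_opC (n : nat) (a b : pow n) : pow_op a b = pow_op b a.
Proof.
rewrite /pow_op disjoint_sym; case: ifP => // _.
by congr ([set _]%classic); apply: val_inj; rewrite /= finset.setUC.
Qed.

Lemma pow_op0 (n : nat) (a : pow n) : pow_op a (pow0 n) a.
Proof.
rewrite /pow_op; have -> : [disjoint val a & val (pow0 n)].
  by rewrite -setI_eq0 finset.setI0.
by apply: val_inj; rewrite /= finset.setU0.
Qed.

Definition Pow (n : nat) : plasma :=
  @Plasma (pow n) (@pow_op n) (pow0 n) (@pow_opC n) (@pow_op0 n).

Lemma pow_preim_subproof (m n : nat) (phi : pmap (fin m) (fin n)) (a : pow n) :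
  ord0 \notin (phi @^-1: val a)%SET.
Proof. by rewrite inE [phi ord0](pmap_pt phi) (valP a). Qed.

Definition pow_preim (m n : nat) (phi : pmap (fin m) (fin n)) (a : pow n) :
  pow m := exist _ (phi @^-1: val a)%SET (pow_preim_subproof phi a).

Lemma pow_preim0 (m n : nat) (phi : pmap (fin m) (fin n)) :
  pow_preim phi (pow0 n) = pow0 m.
Proof. by apply: val_inj; apply/setP => x; rewrite !inE. Qed.

Lemma pow_preimM (m n : nat) (phi : pmap (fin m) (fin n)) (a b : pow n) :
  (pow_preim phi @` pow_op a b `<=`
     pow_op (pow_preim phi a) (pow_preim phi b))%classic.
Proof.
move=> _ [c + <-]; rewrite /pow_op; case: ifP => // ab ->.
have -> : [disjoint val (pow_preim phi a) & val (pow_preim phi b)].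
  move: ab; rewrite -!setI_eq0 => /eqP/setP ab; apply/eqP/setP => x.
  by have := ab (phi x); rewrite !inE.
by apply: val_inj; apply/setP => x; rewrite !inE.
Qed.

Definition Pow_preim (m n : nat) (phi : pmap (fin m) (fin n)) :
  plashom (Pow n) (Pow m) :=
  @PlasHom (Pow n) (Pow m) (pow_preim phi) (pow_preim0 phi) (@pow_preimM _ _ phi).

Section HatH.
Variable M : plasma.

Lemma plcst_subproof (X : plasma) (x x' : X) :
  ((fun=> pl0 : M) @` plop x x' `<=` plop (pl0 : M) pl0)%classic.
Proof. by move=> _ [c _ <-]; exact: plop0. Qed.

Definition plcst (X : plasma) : plashom X M :=
  @PlasHom X M (fun=> pl0) erefl (@plcst_subproof X).

Definition hatH_pset (n : nat) : pset := PSet (plcst (Pow n)).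

Lemma hatH_map_pt (m n : nat) (phi : pmap (fin m) (fin n)) :
  plcomp (plcst (Pow m)) (Pow_preim phi) = plcst (Pow n).
Proof. exact: plashom_eq. Qed.

Definition hatH_map (m n : nat) (phi : pmap (fin m) (fin n)) :
  pmap (hatH_pset m) (hatH_pset n) :=
  @PMap (hatH_pset m) (hatH_pset n) (fun f => plcomp f (Pow_preim phi))
    (hatH_map_pt phi).

Lemma hatH_map_id (n : nat) : hatH_map (pid (fin n)) = pid (hatH_pset n).
Proof.
apply: pmap_eq => f; apply: plashom_eq => a /=; congr (f _).
by apply: val_inj; apply/setP => x; rewrite inE.
Qed.

Lemma hatH_map_comp (l m n : nat) (psi : pmap (fin m) (fin n))
    (phi : pmap (fin l) (fin m)) :
  hatH_map (pcomp psi phi) = pcomp (hatH_map psi) (hatH_map phi).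
Proof.
apply: pmap_eq => f; apply: plashom_eq => a /=; congr (f _).
by apply: val_inj; apply/setP => x; rewrite !inE.
Qed.

Lemma hatH_pset0 (f : hatH_pset 0) : f = pt.
Proof.
apply: plashom_eq => a /=; rewrite -[RHS](plhom0 f); congr (f _).
apply: val_inj; apply/setP => x; rewrite ord1 inE.
exact/negbTE/(valP a).
Qed.

Definition hatH : f1module :=
  @F1Module hatH_pset hatH_map hatH_map_id hatH_map_comp hatH_pset0.

End HatH.

(* Main.v *)
From mathcomp Require Import boolp classical_sets.
From mathcomp Require Import all_boot.
Require Import Defs.
Set Implicit Arguments.
Unset Strict Implicit.
Unset Printing Implicit Defensive.

(** An element of [hatH M n] is a function f on the subsets of {1, ..., n} with
    f({}) = 0 and f(A U B) in f(A) + f(B) for disjoint A and B, and its values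
    are its pushforwards along the indicator maps n_+ -> 1_+.  Pushing a
    partition [Q] forward along the indicator of [S] gives the discrete partition
    of 1_+ exactly when [S] is a union of blocks of [Q], that is, when [S] is
    saturated.  Hence an isomorphism from [Part] to [hatH M] turns [Q] into the
    function that is 0 on saturated sets and a fixed element u <> 0 on all other
    sets ([f1hom_saturated], [f1hom_unsaturated], [top_value_neq0]).

    The sums in [M] cannot tell which functions with values in {0, u} come from
    partitions.  Indeed the partition 0 | 1 2 shows that 0 belongs to u + u, and
    0 + 0 contains 0 and u + 0 contains u in every plasma.  So the function that
    is u on sets of odd cardinality and 0 on the others is an element of
    [hatH M 3] ([parity_morph]).  It would come from a partition of {0, 1, 2, 3}
    for which {1, 2} and {1, 3} are saturated but {1} is not, which is absurd,
    because saturated sets are closed under intersection. *)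

Definition indic_fun (n : nat) (S : pow n) (x : fin n) : fin 1 :=
  if x \in val S then ord_max else ord0.

Lemma indic_pt (n : nat) (S : pow n) : indic_fun S pt = pt.
Proof. by rewrite /indic_fun (negbTE (valP S)). Qed.

Definition indic (n : nat) (S : pow n) : pmap (fin n) (fin 1) :=
  PMap (indic_pt S).

Lemma del0_subproof (n : nat) (A : {set 'I_n.+1}) : ord0 \notin (A :\ ord0)%SET.
Proof. by rewrite !inE eqxx. Qed.

(** Dropping the basepoint turns an explicit finite set into an element of
    [pow n] without a side condition. *)
Definition del0 (n : nat) (A : {set 'I_n.+1}) : pow n :=
  exist _ (A :\ ord0)%SET (del0_subproof A).

(** {1} is the universal point of the contravariant functor [pow]: each [S] is
    its preimage under the indicator of [S]. *)
Lemma pow_preim_indic (n : nat) (S : pow n) :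
  pow_preim (indic S) (del0 [set: 'I_2]%SET) = S.
Proof.
apply: val_inj; apply/setP => x; rewrite !inE andbT /= /indic_fun.
by case: ifP.
Qed.

Definition saturated (n : nat) (Q : part n) (S : {set 'I_n.+1}) : Prop :=
  forall x y, part_rel Q x y -> (x \in S) = (y \in S).

Lemma saturatedI (n : nat) (Q : part n) (S T : {set 'I_n.+1}) :
  saturated Q S -> saturated Q T -> saturated Q (S :&: T)%SET.
Proof. by move=> sS sT x y xy; rewrite !inE (sS x y) ?(sT x y). Qed.

(** Related points have the same image under the indicator of [S]. *)
Lemma part_map_saturated (n : nat) (Q : part n) (S : pow n) :
  saturated Q (val S) -> part_map (indic S) Q = part_pt 1.
Proof.
move=> sS; apply: part_rel_inj => x y; rewrite part_rel_classes part_rel_pt.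
have eqE : equivalence_rel (@eq_op 'I_2) by move=> a b c; split=> // /eqP ->.
rewrite -[RHS](eqv_closure_id eqE); apply/idP/idP; last first.
  rewrite eqv_closure_id // => /eqP ->.
  by have /equivalence_relP[+ _] :=
    @eqv_closure_equiv _ (image_rel (indic S) (part_rel Q)); apply.
apply: eqv_closure_min; first exact: eqv_closure_equiv.
move=> u v /existsP[a /existsP[b /and3P[ab /eqP <- /eqP <-]]].
by apply: sub_eqv_closure; rewrite /= /indic_fun (sS _ _ ab).
Qed.

Definition part_top (n : nat) : part n := classes (fun _ _ : 'I_n.+1 => true).

Lemma part_rel_top (n : nat) (x y : 'I_n.+1) : part_rel (part_top n) x y.
Proof. by rewrite part_rel_classes; apply: sub_eqv_closure. Qed.

Lemma part_top1_neq_pt : part_top 1 <> part_pt 1.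
Proof.
by move=> E; have := part_rel_top (ord0 : 'I_2) ord_max; rewrite E part_rel_pt.
Qed.

Lemma ord2_cases (x : 'I_2) : x = ord0 \/ x = ord_max.
Proof. by case: x => [[|[|//]]] i; [left | right]; exact: val_inj. Qed.

(** A block that meets [S] and its complement glues the two points of 1_+. *)
Lemma part_map_unsaturated (n : nat) (Q : part n) (S : pow n) :
  ~ saturated Q (val S) -> part_map (indic S) Q = part_top 1.
Proof.
move=> nS; apply: part_rel_inj => x y; rewrite part_rel_top.
apply/idP; apply: contrapT => nxy; apply: nS => a b ab.
set P := part_map (indic S) Q in nxy.
have abP : part_rel P (indic S a) (indic S b).
  rewrite part_rel_classes; apply: sub_eqv_closure.
  by apply/existsP; exists a; apply/existsP; exists b; rewrite ab !eqxx.
have /equivalence_relP[rP tP] := part_rel_equiv P.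
have sP u v : part_rel P u v = part_rel P v u.
  by apply/idP/idP => uv; rewrite -(tP _ _ uv); exact: rP.
have allP : part_rel P ord0 ord_max -> part_rel P x y.
  move=> P01; have P10 : part_rel P ord_max ord0 by rewrite sP.
  by case: (ord2_cases x) => ->; case: (ord2_cases y) => ->.
apply: contrapT => nab; apply/nxy/allP; move: abP nab; rewrite /= /indic_fun.
by case: (a \in _); case: (b \in _) => //; rewrite sP.
Qed.

Section Value.
Variables (M : plasma) (F : f1hom Part (hatH M)).

(** The common value u at all unsaturated sets. *)
Definition top_value : M := (F 1 (part_top 1) : hatH M 1) (del0 [set: 'I_2]%SET).

(** By naturality, as [S] is the preimage of {1} under its indicator. *)
Lemma f1hom_indic (n : nat) (Q : part n) (S : pow n) :
  (F n Q : hatH M n) S =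
  (F 1 (part_map (indic S) Q) : hatH M 1) (del0 [set: 'I_2]%SET).
Proof.
have /= := congr1 (fun h : pmap (Part n) (hatH M 1) =>
  (pfun h Q : hatH M 1) (del0 [set: 'I_2]%SET)) (f1nat F (indic S)).
by rewrite pow_preim_indic => ->.
Qed.

Lemma f1hom_saturated (n : nat) (Q : part n) (S : pow n) :
  saturated Q (val S) -> (F n Q : hatH M n) S = pl0.
Proof.
move=> sS; rewrite f1hom_indic part_map_saturated //.
by have /= -> := pmap_pt (F 1).
Qed.

Lemma f1hom_unsaturated (n : nat) (Q : part n) (S : pow n) :
  ~ saturated Q (val S) -> (F n Q : hatH M n) S = top_value.
Proof. by move=> nS; rewrite f1hom_indic part_map_unsaturated. Qed.

(** A morphism out of [Pow 1] is determined by its value at {1}, so if this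
    value vanished on [part_top 1], the map [F 1] would not be injective. *)
Lemma top_value_neq0 : injective (F 1) -> top_value <> pl0.
Proof.
move=> injF u0; apply: part_top1_neq_pt; apply: injF.
rewrite [RHS](pmap_pt (F 1)); apply: plashom_eq => S /=.
have [-> | ->] : S = del0 [set: 'I_2]%SET \/ S = pow0 1; last exact: plhom0.
  have S0 := negbTE (valP S).
  have [S1|/negbTE S1] := boolP (ord_max \in val S); [left | right];
    by apply: val_inj; apply/setP => x; case: (ord2_cases x) => ->;
      rewrite ?S0 ?S1 !inE.
exact: u0.
Qed.

Lemma disjoint_plop (n : nat) (f : hatH M n) (a b : pow n) :
  [disjoint val a & val b] -> plop (f a) (f b) (f (powU a b)).
Proof.
by move=> ab; apply: plhomM; exists (powU a b) => //=; rewrite /pow_op ab.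
Qed.

(** Read off from the partition 0 | 1 2, for which {1, 2} is saturated while
    {1} and {2} are not. *)
Lemma plop_top_value : plop top_value top_value pl0.
Proof.
pose e : rel 'I_3 := fun x y => (x == ord0) == (y == ord0).
have ee : equivalence_rel e.
  by move=> x y z; split; rewrite /e ?eqxx // => /eqP ->.
pose i1 : 'I_3 := inord 1; pose i2 : 'I_3 := ord_max.
have v1 : val i1 = 1 by rewrite /= inordK.
have E x y : part_rel (classes e) x y = e x y.
  by rewrite part_rel_classes eqv_closure_id.
have n12 : part_rel (classes e) i1 i2 by rewrite E /e -!val_eqE v1.
have := @disjoint_plop 2 (F 2 (classes e)) (del0 [set i1]%SET) (del0 [set i2]%SET).
rewrite f1hom_unsaturated; last first.
  by move=> /(_ _ _ n12); rewrite !inE -!val_eqE v1.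
rewrite f1hom_unsaturated; last first.
  by move=> /(_ _ _ n12); rewrite !inE -!val_eqE v1.
rewrite f1hom_saturated; last first.
  move=> x y; rewrite E /e !inE -!val_eqE v1.
  by case: x y => [[|[|[|//]]] ?] [[|[|[|//]]] ?].
apply; rewrite -setI_eq0; apply/eqP/setP => x; rewrite !inE -!val_eqE v1.
by case: x => [[|[|[|//]]] ?].
Qed.

Definition parity (n : nat) (S : Pow n) : M :=
  if odd #|val S| then top_value else pl0.

Lemma parity0 (n : nat) : parity (pl0 : Pow n) = pl0.
Proof. by rewrite /parity cards0. Qed.

(** Disjoint unions add cardinals, so the only case that is not an instance of
    the weak identity law is odd + odd = even, which is 0 in u + u. *)
Lemma parityM (n : nat) (a b : Pow n) :
  (@parity n @` plop a b `<=` plop (parity a) (parity b))%classic.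
Proof.
move=> _ [c + <-]; rewrite /= /pow_op; case: ifP => // ab ->.
rewrite /parity /= cardsU; move: ab; rewrite -setI_eq0 => /eqP ->.
rewrite cards0 subn0 oddD.
case: (odd #|val a|); case: (odd #|val b|) => /=.
- exact: plop_top_value.
- exact: plop0.
- by rewrite plopC; exact: plop0.
exact: plop0.
Qed.

Definition parity_morph (n : nat) : hatH M n :=
  @PlasHom (Pow n) M (@parity n) (@parity0 n) (@parityM n).

End Value.

Theorem mainTheorem8 : ~ exists M : plasma, f1iso Part (hatH M).
Proof.
case=> M [F [G [GF FG]]].
have u0 : top_value F <> pl0.
  apply: top_value_neq0 => P Q PQ.
  by have /= K R := congr1 (fun h => pfun h R) (GF 1); rewrite -(K P) PQ.
pose Q : part 3 := G 3 (parity_morph F 3).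
have FQ : F 3 Q = parity_morph F 3.
  exact: (congr1 (fun h => pfun h (parity_morph F 3)) (FG 3)).
have satE (S : pow 3) : ~~ odd #|val S| -> saturated Q (val S).
  move=> eS; apply: contrapT => nS; apply: u0.
  by rewrite -(f1hom_unsaturated F nS) FQ /= /parity (negbTE eS).
have satO (S : pow 3) : odd #|val S| -> ~ saturated Q (val S).
  move=> oS sS; apply: u0; move: (f1hom_saturated F sS).
  by rewrite FQ /= /parity oS.
pose i1 : 'I_4 := inord 1; pose i2 : 'I_4 := inord 2; pose i3 : 'I_4 := ord_max.
have v1 : val i1 = 1 by rewrite /= inordK.
have v2 : val i2 = 2 by rewrite /= inordK.
have s12 : saturated Q (val (del0 [set i1; i2]%SET)).
  apply: satE; suff -> : val (del0 [set i1; i2]%SET) = [set i1; i2]%SET.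
    by rewrite cards2 -val_eqE v1 v2.
  apply/setP => x; rewrite !inE -!val_eqE v1 v2.
  by case: x => [[|[|[|[|//]]]] ?].
have s13 : saturated Q (val (del0 [set i1; i3]%SET)).
  apply: satE; suff -> : val (del0 [set i1; i3]%SET) = [set i1; i3]%SET.
    by rewrite cards2 -val_eqE v1.
  apply/setP => x; rewrite !inE -!val_eqE v1.
  by case: x => [[|[|[|[|//]]]] ?].
have E1 : (val (del0 [set i1; i2]%SET) :&: val (del0 [set i1; i3]%SET))%SET =
    val (del0 [set i1]%SET).
  apply/setP => x; rewrite !inE -!val_eqE v1 v2.
  by case: x => [[|[|[|[|//]]]] ?].
apply: (satO (del0 [set i1]%SET)); last by rewrite -E1; exact: saturatedI.
suff -> : val (del0 [set i1]%SET) = [set i1]%SET by rewrite cards1.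
apply/setP => x; rewrite !inE -!val_eqE v1.
by case: x => [[|[|[|[|//]]]] ?].
Qed.
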